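(* Let $ABC$ be a nondegenerate triangle with semiperimeter $s$, inradius $r$ and circumradius $R$. Then $$R-2r\ \ge\ \frac{d_I}{R},$$ $$4R^2+4Rr+3r^2-s^2\ \ge\ d_I,$$ $$s^2-r(16R-5r)\ \ge\ 9\,d_I,$$ $$4R+r-\sqrt3\,s\ \ge\ \frac{d_I}{4R+r+\sqrt3\,s}.$$
   Context: Let $I$, $O$, $H$ be the incenter, circumcenter and orthocenter of $ABC$. For real $\lambda$, $\mathrm{ELD}_I(\lambda)=|XI|^2$ where $X=(1-\lambda)H+\lambda O$ (affine combination). $d_I$ denotes the minimum value of $\mathrm{ELD}_I(\lambda)$ over $\lambda\in\mathbb{R}$, i.e. the squared distance from $I$ to the Euler line. When the triangle is not equilateral, $$d_I=-\frac{s^4-2(2R^2+10Rr-r^2)s^2+r(4R+r)^3}{4(9R^2+8Rr+2r^2-2s^2)},$$ where the factor $9R^2+8Rr+2r^2-2s^2=|OH|^2$ is nonzero. In the equilateral case $H=O=I$, and $d_I=0$. *)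

(* Defs.v *)
From HB Require Import structures.
From mathcomp Require Import all_boot all_order all_algebra.
From mathcomp Require Import all_classical all_reals.
From mathcomp Require Import ring.
Set Implicit Arguments.
Unset Strict Implicit.
Unset Printing Implicit Defensive.
Import Order.TTheory GRing.Theory Num.Theory.
Local Open Scope classical_set_scope.
Local Open Scope ring_scope.

(* The Euclidean plane is 'rV[K]_2 for K : realType. The norm of the library on
   'rV[K]_2 is the sup norm, hence the Euclidean distance below. *)

Definition dot (K : realType) (u v : 'rV[K]_2) : K :=
  \sum_(i < 2) u 0 i * v 0 i.

Definition edist (K : realType) (P Q : 'rV[K]_2) : K :=
  Num.sqrt (dot (P - Q) (P - Q)).

Definition nondegenerate_triangle (K : realType) (A B C : 'rV[K]_2) : Prop :=
  free [:: B - A; C - A].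

Definition semiperimeter (K : realType) (A B C : 'rV[K]_2) : K :=
  (edist B C + edist C A + edist A B) / 2.

Definition circumcircle (K : realType) (A B C O : 'rV[K]_2) (R : K) : Prop :=
  [/\ edist O A = R, edist O B = R & edist O C = R].

Definition orthocenter (K : realType) (A B C H : 'rV[K]_2) : Prop :=
  [/\ dot (H - A) (B - C) = 0, dot (H - B) (C - A) = 0
    & dot (H - C) (A - B) = 0].

Definition segment (K : realType) (P Q : 'rV[K]_2) : set 'rV[K]_2 :=
  [set X | exists2 t : K, 0 <= t <= 1 & X = (1 - t) *: P + t *: Q].

(* The point of tangency T lies on the segment PQ, not merely on the line PQ:
   this is what tells the incircle from the three excircles. *)
Definition tangent_to_side (K : realType) (I : 'rV[K]_2) (r : K)
    (P Q : 'rV[K]_2) : Prop :=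
  exists T : 'rV[K]_2,
    [/\ segment P Q T, dot (I - T) (P - Q) = 0 & edist I T = r].

Definition incircle (K : realType) (A B C I : 'rV[K]_2) (r : K) : Prop :=
  [/\ 0 < r, tangent_to_side I r B C, tangent_to_side I r C A
    & tangent_to_side I r A B].

Definition ELD (K : realType) (H O P : 'rV[K]_2) (lambda : K) : K :=
  edist ((1 - lambda) *: H + lambda *: O) P ^+ 2.

(* The infimum is attained (lemma min_ELDP), including when H = O. *)
Definition min_ELD (K : realType) (H O P : 'rV[K]_2) : K :=
  inf (range (ELD H O P)).

Lemma ELDE (K : realType) (H O P : 'rV[K]_2) (l : K) :
  ELD H O P l = dot (O - H) (O - H) * l ^+ 2
    + 2 * dot (O - H) (H - P) * l + dot (H - P) (H - P).
Proof.
rewrite /ELD /edist sqr_sqrtr; last first.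
  by apply: sumr_ge0 => i _; rewrite -expr2 sqr_ge0.
rewrite /dot !big_ord_recl !big_ord0 !mxE; ring.
Qed.

Lemma ELD_attains (K : realType) (H O P : 'rV[K]_2) :
  exists l0 : K, forall l, ELD H O P l0 <= ELD H O P l.
Proof.
have [HO|HO] := eqVneq (dot (O - H) (O - H)) 0.
  have OH : O - H = 0.
    apply/rowP => i; rewrite [RHS]mxE; apply/eqP; rewrite -sqrf_eq0; apply/eqP.
    move: HO; rewrite /dot => /eqP.
    rewrite psumr_eq0; last by move=> j _; rewrite -expr2 sqr_ge0.
    by move=> /allP /(_ i (mem_index_enum i)) /= /eqP; rewrite -expr2.
  exists 0 => l; rewrite !ELDE HO OH /dot.
  by rewrite big1 ?mulr0 ?mul0r// => i _; rewrite mxE mul0r.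
have HO0 : 0 < dot (O - H) (O - H).
  by rewrite lt_neqAle eq_sym HO; apply: sumr_ge0 => i _;
    rewrite -expr2 sqr_ge0.
exists (- dot (O - H) (H - P) / dot (O - H) (O - H)) => l.
rewrite !ELDE; move: (dot (O - H) (H - P)) (dot (H - P) (H - P)) => b c.
move: (dot (O - H) (O - H)) HO HO0 => a a0 ap.
rewrite -subr_ge0.
have -> : a * l ^+ 2 + 2 * b * l + c -
    (a * (- b / a) ^+ 2 + 2 * b * (- b / a) + c) = a * (l + b / a) ^+ 2.
  by field.
by rewrite mulr_ge0 ?sqr_ge0 ?ltW.
Qed.

Lemma min_ELDP (K : realType) (H O P : 'rV[K]_2) :
  (exists l0, ELD H O P l0 = min_ELD H O P) /\
  (forall l, min_ELD H O P <= ELD H O P l).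
Proof.
have [l0 l0P] := ELD_attains H O P.
have lb : lbound (range (ELD H O P)) (ELD H O P l0) by move=> _ [l _ <-].
have le l : min_ELD H O P <= ELD H O P l.
  by apply: ge_inf; [exists (ELD H O P l0) | exists l].
split=> //; exists l0; apply/eqP; rewrite eq_le le andbT.
by apply: lb_le_inf => //; exists (ELD H O P l0), l0.
Qed.

(* Main.v *)
Require Import Defs.
From mathcomp Require Import all_boot all_order all_algebra.
From mathcomp Require Import all_classical all_reals.
From mathcomp Require Import ring lra.
Set Implicit Arguments.
Unset Strict Implicit.
Unset Printing Implicit Defensive.
Import Order.TTheory GRing.Theory Num.Theory.
Local Open Scope ring_scope.

(** The number d_I is at most |XI|^2 for every point X of the Euler line.  The
four inequalities are this bound at X = O, H, the centroid (lambda = 2/3) and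
the de Longchamps point 2O - H (lambda = 2), where |XI|^2 equals R^2 - 2Rr,
4R^2 + 4Rr + 3r^2 - s^2, (s^2 - 16Rr + 5r^2)/9 and (4R + r)^2 - 3s^2.

To compute |XI|^2, take I as the origin and let x, y, z be the tangent lengths
from A, B, C.  Then A.A = r^2 + x^2, A.B = r^2 - xy and so on, the vanishing
Gram determinant of A, B, C gives r^2 (x + y + z) = xyz, and that of
A - O, B - O, C - O gives 4Rr = xy + yz + zx - r^2.  With H = A + B + C - 2O
everything is then a polynomial identity in R, r, x, y, z. *)

Section PlaneDot.
Variable K : realType.
Implicit Types u v w P Q T : 'rV[K]_2.

Lemma dot2E u v :
  dot u v = u 0 ord0 * v 0 ord0 + u 0 (lift ord0 ord0) * v 0 (lift ord0 ord0).
Proof. by rewrite /dot !big_ord_recl big_ord0 addr0. Qed.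

Lemma dotC u v : dot u v = dot v u.
Proof. by rewrite !dot2E; ring. Qed.

Lemma dot_ge0 u : 0 <= dot u u.
Proof. by rewrite dot2E -!expr2 addr_ge0 ?sqr_ge0. Qed.

Lemma dot_eq0 u : dot u u = 0 -> u = 0.
Proof.
move=> /eqP; rewrite /dot psumr_eq0 => [/allP u0|i _]; last first.
  by rewrite -expr2 sqr_ge0.
apply/rowP => i; rewrite [RHS]mxE; apply/eqP.
by have := u0 i (mem_index_enum i); rewrite /= -expr2 sqrf_eq0.
Qed.

Lemma edist_ge0 P Q : 0 <= edist P Q.
Proof. exact: sqrtr_ge0. Qed.

Lemma sqr_edist P Q : edist P Q ^+ 2 = dot (P - Q) (P - Q).
Proof. by rewrite sqr_sqrtr ?dot_ge0. Qed.

(** The squared area of the parallelogram spanned by [u] and [v]. *)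
Definition gram2 u v := dot u u * dot v v - dot u v ^+ 2.

(** Three vectors of a plane are linearly dependent, so their Gram determinant, expanded here,
    vanishes. *)
Lemma gram3_eq0 u v w :
  dot u u * dot v v * dot w w + 2 * dot u v * dot v w * dot w u
  - dot u u * dot v w ^+ 2 - dot v v * dot w u ^+ 2
  - dot w w * dot u v ^+ 2 = 0.
Proof. rewrite !dot2E; ring. Qed.

(** Equality case of Cauchy-Schwarz: the component of [u] orthogonal to [v] has squared norm
    [gram2 u v / dot v v]. *)
Lemma free_gram2_neq0 u v : free [:: u; v] -> gram2 u v != 0.
Proof.
rewrite free_cons span_seq1 seq1_free => /andP[uNv v0]; apply/eqP => g0.
have vv0 : dot v v != 0 by apply: contra_neq v0; exact: dot_eq0.
case/negP: uNv; apply/vlineP; exists (dot u v / dot v v).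
apply/eqP; rewrite -subr_eq0; apply/eqP/dot_eq0; set k := _ / _.
have -> : dot (u - k *: v) (u - k *: v)
    = dot u u - 2 * k * dot u v + k ^+ 2 * dot v v.
  by rewrite !dot2E !mxE; ring.
rewrite -[RHS](mul0r (dot v v)^-1) -g0 /gram2 /k; by field.
Qed.

(** Under the two orthogonality hypotheses, [gram3_eq0 w u v] collapses to
    [dot w w * gram2 u v = 0]. *)
Lemma gram2_orthogonal u v w : gram2 u v != 0 ->
  dot w u = 0 -> dot w v = 0 -> w = 0.
Proof.
move=> g0 wu wv; apply: dot_eq0; apply/eqP.
rewrite -(mulIr_eq0 _ (mulIf g0)); apply/eqP.
rewrite -[RHS](gram3_eq0 w u v) wu (dotC v) wv /gram2; ring.
Qed.

(** The point of tangency cuts the side into [y] and [z], nonnegative because it lies on the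
    segment; then Pythagoras. *)
Lemma tangent_to_side_lengths (I : 'rV[K]_2) (r : K) P Q :
  tangent_to_side I r P Q ->
  exists y z, [/\ 0 <= y, 0 <= z, edist P Q = y + z,
    dot (P - I) (P - I) = r ^+ 2 + y ^+ 2
    & dot (Q - I) (Q - I) = r ^+ 2 + z ^+ 2].
Proof.
move=> [T [[t /andP[t0 t1] TE] IT_PQ IT]].
exists (t * edist P Q), ((1 - t) * edist P Q).
split; rewrite ?mulr_ge0 ?edist_ge0 ?subr_ge0 //; first by ring.
- rewrite -IT exprMn !sqr_edist -[LHS](addr0) -(mulr0 (2 * t)) -IT_PQ TE.
  rewrite !dot2E !mxE; ring.
- rewrite -IT exprMn !sqr_edist -[LHS](addr0) -(mulr0 (2 * (t - 1))) -IT_PQ TE.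
  rewrite !dot2E !mxE; ring.
Qed.

Lemma incircle_tangent_lengths (A B C I : 'rV[K]_2) (r : K) :
  incircle A B C I r ->
  exists x y z, [/\ [/\ 0 <= x, 0 <= y & 0 <= z],
    [/\ edist B C = y + z, edist C A = z + x & edist A B = x + y],
    [/\ dot (A - I) (A - I) = r ^+ 2 + x ^+ 2,
        dot (B - I) (B - I) = r ^+ 2 + y ^+ 2
      & dot (C - I) (C - I) = r ^+ 2 + z ^+ 2]
    & [/\ dot (A - I) (B - I) = r ^+ 2 - x * y,
        dot (B - I) (C - I) = r ^+ 2 - y * z
      & dot (C - I) (A - I) = r ^+ 2 - z * x]].
Proof.
move=> [_ /tangent_to_side_lengths[y [z [y0 z0 BC IB IC]]]].
move=> /tangent_to_side_lengths[z' [x [z'0 x0 CA IC' IA]]].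
move=> /tangent_to_side_lengths[x' [y' [x'0 y'0 AB IA' IB']]].
(* The two tangents from a vertex are equal: both are nonnegative, with the same square. *)
have eq_of_sqr (a b d : K) : 0 <= a -> 0 <= b ->
    d = r ^+ 2 + a ^+ 2 -> d = r ^+ 2 + b ^+ 2 -> b = a.
  move=> a0 b0 -> /addrI/eqP ab; apply/eqP; rewrite eq_sym.
  by rewrite -(eqrXn2 (n := 2)).
have ?: z' = z by exact: eq_of_sqr IC IC'.
have ?: y' = y by exact: eq_of_sqr IB IB'.
have ?: x' = x by exact: eq_of_sqr IA IA'.
subst x' y' z'; exists x, y, z; split=> //.
have dotE P Q : 2 * dot (P - I) (Q - I)
    = dot (P - I) (P - I) + dot (Q - I) (Q - I) - edist P Q ^+ 2.
  by rewrite sqr_edist !dot2E !mxE; ring.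
have two0 : (2 : K) != 0 by rewrite pnatr_eq0.
split; apply: (mulfI two0); rewrite dotE ?AB ?BC ?CA ?IA ?IB ?IC; ring.
Qed.

(** The candidate minus C is (A - O) + (B - O), orthogonal to A - B since |OA| = |OB|; likewise for
    the altitude from B. So its difference with [H] is orthogonal to two independent sides. *)
Lemma orthocenterE (A B C O H : 'rV[K]_2) (R : K) :
  nondegenerate_triangle A B C -> circumcircle A B C O R ->
  orthocenter A B C H -> H = A + B + C - 2 *: O.
Proof.
move=> /free_gram2_neq0 g0 [OA OB OC] [_ HB HC].
have dA : dot (O - A) (O - A) = R ^+ 2 by rewrite -sqr_edist OA.
have dB : dot (O - B) (O - B) = R ^+ 2 by rewrite -sqr_edist OB.
have dC : dot (O - C) (O - C) = R ^+ 2 by rewrite -sqr_edist OC.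
apply/eqP; rewrite -subr_eq0; apply/eqP/(gram2_orthogonal g0).
- rewrite -[RHS](subrr (R ^+ 2)) -{1}dA -dB -[RHS]subr0 -[in RHS]HC.
  by rewrite !dot2E !mxE; ring.
- rewrite -[RHS](subrr (R ^+ 2)) -{1}dA -dC -[RHS]addr0 -[in RHS]HB.
  by rewrite !dot2E !mxE; ring.
Qed.

(* The coefficients of (1 - l)^2, (1 - l)(3l - 2) and (3l - 2)^2 are the values
   of |S|^2, 2 S.O and |O|^2 for S = A + B + C and I as the origin. *)
Lemma ELD_incenter (A B C I O H : 'rV[K]_2) (r R l : K) :
  nondegenerate_triangle A B C -> incircle A B C I r ->
  circumcircle A B C O R -> orthocenter A B C H ->
  let s := semiperimeter A B C in
  [/\ 0 < R, 0 < s & ELD H O I l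
   = (1 - l) ^+ 2 * (s ^+ 2 - 16 * R * r + 5 * r ^+ 2)
   + (1 - l) * (3 * l - 2) * (s ^+ 2 - 14 * R * r + r ^+ 2)
   + (3 * l - 2) ^+ 2 * (R ^+ 2 - 2 * R * r)].
Proof.
move=> ndeg inc circ orth s.
have HE := orthocenterE ndeg circ orth.
have r0 : 0 < r by case: inc.
have [x [y [z [[x0 y0 z0] [BC CA AB] [IA IB IC] [IAB IBC ICA]]]]] :=
  incircle_tangent_lengths inc.
have [OA OB OC] := circ.
have R0 : 0 <= R by rewrite -OA edist_ge0.
have sE : s = x + y + z.
  by rewrite /s /semiperimeter BC CA AB; field.
(* Heron's formula, as [gram2] is four times the squared area of the triangle. It forces x, y, z to
   be nonzero. *)
have gE : gram2 (B - A) (C - A) = 4 * (x + y + z) * (x * y * z).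
  have -> : gram2 (B - A) (C - A) =
      (dot (B - I) (B - I) - 2 * dot (A - I) (B - I) + dot (A - I) (A - I)) *
      (dot (C - I) (C - I) - 2 * dot (C - I) (A - I) + dot (A - I) (A - I)) -
      (dot (B - I) (C - I) - dot (A - I) (B - I) - dot (C - I) (A - I)
       + dot (A - I) (A - I)) ^+ 2.
    by rewrite /gram2 !dot2E !mxE; ring.
  by rewrite IA IB IC IAB IBC ICA; ring.
have := free_gram2_neq0 ndeg; rewrite gE !mulf_eq0 !negb_or.
move=> /andP[/andP[_ s_neq0] /andP[/andP[x_neq0 y_neq0] z_neq0]].
have x_gt0 : 0 < x by rewrite lt_neqAle eq_sym x_neq0.
have y_gt0 : 0 < y by rewrite lt_neqAle eq_sym y_neq0.
have z_gt0 : 0 < z by rewrite lt_neqAle eq_sym z_neq0.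
have s_gt0 : 0 < x + y + z by rewrite !addr_gt0.
(* The Gram determinant of A, B, C seen from I factors as 4xyz (r^2 (x + y + z) - xyz). *)
have rs : r ^+ 2 * (x + y + z) = x * y * z.
  have xyz0 : 4 * (x * y * z) != 0 by rewrite !mulf_neq0 ?pnatr_eq0.
  apply/eqP; rewrite -subr_eq0 -(mulIr_eq0 _ (mulIf xyz0)); apply/eqP.
  rewrite -[RHS](gram3_eq0 (A - I) (B - I) (C - I)) IA IB IC IAB IBC ICA; ring.
have dA : dot (A - O) (A - O) = R ^+ 2.
  by rewrite -OA sqr_edist !dot2E !mxE; ring.
have dB : dot (B - O) (B - O) = R ^+ 2.
  by rewrite -OB sqr_edist !dot2E !mxE; ring.
have dC : dot (C - O) (C - O) = R ^+ 2.
  by rewrite -OC sqr_edist !dot2E !mxE; ring.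
have dotO P Q : dot (P - O) (P - O) = R ^+ 2 -> dot (Q - O) (Q - O) = R ^+ 2 ->
    dot (P - O) (Q - O) = R ^+ 2 - edist P Q ^+ 2 / 2.
  move=> dP dQ; rewrite sqr_edist.
  have -> : dot (P - Q) (P - Q) = dot (P - O) (P - O) - 2 * dot (P - O) (Q - O)
      + dot (Q - O) (Q - O) by rewrite !dot2E !mxE; ring.
  by rewrite dP dQ; field.
have := (dotO _ _ dA dB, dotO _ _ dB dC, dotO _ _ dC dA).
rewrite AB BC CA => -[[dotAB dotBC] dotCA].
(* The square of abc = 4R times the area, the area being r (x + y + z). *)
have Rabc : (4 * R * r * (x + y + z)) ^+ 2
    = ((x + y) * (y + z) * (z + x)) ^+ 2.
  have g3 := gram3_eq0 (A - O) (B - O) (C - O).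
  rewrite dA dB dC dotAB dotBC dotCA in g3.
  have -> : (4 * R * r * (x + y + z)) ^+ 2
    = 16 * R ^+ 2 * (x + y + z) * (r ^+ 2 * (x + y + z)) by ring.
  apply/eqP; rewrite rs -subr_eq0; apply/eqP.
  by rewrite -[RHS](mulr0 4) -[in RHS]g3; field.
have {}Rabc : 4 * R * r * (x + y + z) = (x + y) * (y + z) * (z + x).
  apply/eqP; rewrite -(eqrXn2 (n := 2)) ?Rabc//.
  - by rewrite !mulr_ge0 ?(ltW s_gt0) ?(ltW r0).
  - by rewrite !mulr_ge0 ?addr_ge0.
have R_gt0 : 0 < R.
  rewrite lt_neqAle R0 andbT eq_sym; apply/eqP => RE.
  have : 0 < (x + y) * (y + z) * (z + x) by rewrite !mulr_gt0 ?addr_gt0.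
  by rewrite -Rabc RE mulr0 !mul0r ltxx.
have Rr : x * y + y * z + z * x = 4 * R * r + r ^+ 2.
  apply: (mulIf s_neq0); rewrite [RHS]mulrDl Rabc rs; ring.
set a := A - I in IA IAB ICA *; set b := B - I in IB IAB IBC *.
set c := C - I in IC IBC ICA *; pose o := O - I.
have OP P : 2 * dot (P - I) o
    = dot (P - I) (P - I) + dot o o - dot (P - O) (P - O).
  by rewrite /o !dot2E !mxE; ring.
(* The incenter has the side lengths as barycentric weights. The squared norm of the sum is 4(x + y
   + z)(r^2 (x + y + z) - xyz), which is 0 by [rs]. *)
have abc0 : (y + z) *: a + (z + x) *: b + (x + y) *: c = 0.
  apply: dot_eq0.
  have -> : dot ((y + z) *: a + (z + x) *: b + (x + y) *: c)
        ((y + z) *: a + (z + x) *: b + (x + y) *: c) =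
      (y + z) ^+ 2 * dot a a + (z + x) ^+ 2 * dot b b + (x + y) ^+ 2 * dot c c
      + 2 * (y + z) * (z + x) * dot a b + 2 * (z + x) * (x + y) * dot b c
      + 2 * (y + z) * (x + y) * dot c a.
    by rewrite !dot2E !mxE; ring.
  rewrite IA IB IC IAB IBC ICA.
  rewrite -[RHS](mulr0 (4 * (x + y + z))) -(subrr (x * y * z)) -{1}rs; ring.
(* Euler's formula for |OI|^2: pairing [abc0] with [o] gives, through [OP], a linear equation in
   [dot o o]. *)
have oo : dot o o = R ^+ 2 - 2 * R * r.
  have := congr1 (fun w => 2 * dot w o) abc0.
  have -> : 2 * dot ((y + z) *: a + (z + x) *: b + (x + y) *: c) o
      = (y + z) * (2 * dot a o) + (z + x) * (2 * dot b o)
        + (x + y) * (2 * dot c o).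
    by rewrite !dot2E !mxE; ring.
  have -> : 2 * dot 0 o = 0 by rewrite dot2E !mxE; ring.
  rewrite /a /b /c !OP -/a -/b -/c IA IB IC dA dB dC => e.
  have s2_neq0 : 2 * (x + y + z) != 0 by rewrite mulf_neq0 ?pnatr_eq0.
  apply: (mulfI s2_neq0); apply/eqP; rewrite -subr_eq0; apply/eqP.
  rewrite -[RHS]e.
  have -> : 2 * (x + y + z) * (R ^+ 2 - 2 * R * r)
     = 2 * (x + y + z) * R ^+ 2 - (4 * R * r * (x + y + z)) by ring.
  apply/eqP; rewrite Rabc -subr_eq0; apply/eqP.
  rewrite -[RHS](mulr0 2) -(subrr (x * y * z)) -{2}rs; ring.
have s2 : s ^+ 2 = x ^+ 2 + y ^+ 2 + z ^+ 2 + 2 * (4 * R * r + r ^+ 2).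
  by rewrite -Rr sE; ring.
split=> //; first by rewrite sE.
(* Seen from I, H is a + b + c - 2o, so the point of parameter l is (1 - l)(a + b + c) + (3l -
   2)o. *)
have -> : ELD H O I l
  = (1 - l) ^+ 2 * (dot a a + dot b b + dot c c
      + 2 * (dot a b + dot b c + dot c a))
  + (1 - l) * (3 * l - 2) * (2 * dot a o + 2 * dot b o + 2 * dot c o)
  + (3 * l - 2) ^+ 2 * dot o o.
  by rewrite /ELD sqr_edist HE /a /b /c /o !dot2E !mxE; ring.
rewrite /a /b /c !OP -/a -/b -/c IA IB IC IAB IBC ICA dA dB dC oo s2.
have -> : r ^+ 2 - x * y + (r ^+ 2 - y * z) + (r ^+ 2 - z * x)
   = 3 * r ^+ 2 - (4 * R * r + r ^+ 2) by rewrite -Rr; ring.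
ring.
Qed.

End PlaneDot.

Theorem theorem3 (K : realType) (A B C I O H : 'rV[K]_2) (r R : K)
    (ABC_nondegenerate : nondegenerate_triangle A B C)
    (I_r_incircle : incircle A B C I r)
    (O_R_circumcircle : circumcircle A B C O R)
    (H_orthocenter : orthocenter A B C H) :
  let s := semiperimeter A B C in
  let dI := min_ELD H O I in
  [/\ R - 2 * r >= dI / R,
      4 * R ^+ 2 + 4 * R * r + 3 * r ^+ 2 - s ^+ 2 >= dI,
      s ^+ 2 - r * (16 * R - 5 * r) >= 9 * dI
    & 4 * R + r - Num.sqrt 3 * s >= dI / (4 * R + r + Num.sqrt 3 * s)].
Proof.
move=> s dI.
have ELDl l := ELD_incenter l ABC_nondegenerate I_r_incircle O_R_circumcircle
  H_orthocenter.
have [R0 s0 _] := ELDl 0; rewrite -/s in s0.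
have r0 : 0 < r by case: I_r_incircle.
have dI_le l := (min_ELDP H O I).2 l; rewrite -/dI in dI_le.
have sqrt3 : Num.sqrt 3 ^+ 2 = 3 :> K by rewrite sqr_sqrtr ?ler0n.
split.
- rewrite ler_pdivrMr //; apply: le_trans (dI_le 1) _.
  by have [_ _ ->] := ELDl 1; rewrite -/s; lra.
- apply: le_trans (dI_le 0) _.
  by have [_ _ ->] := ELDl 0; rewrite -/s; lra.
(* At 2/3 the terms in 3l - 2 vanish and (1 - l)^2 = 1/9 gives the factor 9. *)
- rewrite mulrC -ler_pdivlMr ?ltr0n //; apply: le_trans (dI_le (2 / 3)) _.
  by have [_ _ ->] := ELDl (2 / 3); rewrite -/s; lra.
- rewrite ler_pdivrMr; last first.
    by rewrite (addr_gt0 _ (mulr_gt0 _ s0)) ?addr_gt0 ?mulr_gt0 ?sqrtr_gt0 ?ltr0n.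
  apply: le_trans (dI_le 2) _; have [_ _ ->] := ELDl 2; rewrite -/s.
  have -> : (4 * R + r - Num.sqrt 3 * s) * (4 * R + r + Num.sqrt 3 * s)
    = (4 * R + r) ^+ 2 - Num.sqrt 3 ^+ 2 * s ^+ 2 by ring.
  by rewrite sqrt3; lra.
Qed.
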